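(* Let $\mathbb{L}$ be the alternate lattice, i.e. the $\epsilon$-horizontally oriented lattice on $\mathbb{Z}^2$ with the deterministic sequence $\epsilon_y=(-1)^y$, $y\in\mathbb{Z}$. Then the simple random walk on $\mathbb{L}$ is recurrent.
   Context: Given a $\{-1,1\}$-valued sequence $\epsilon=(\epsilon_y)_{y\in\mathbb{Z}}$, the $\epsilon$-horizontally oriented lattice is the directed graph with vertex set $\mathbb{Z}^2$ in which there is an oriented edge from $u=(u_1,u_2)$ to $v=(v_1,v_2)$ if and only if either $v_1=u_1$ and $v_2=u_2\pm 1$, or $v_2=u_2$ and $v_1=u_1+\epsilon_{u_2}$. Thus vertical edges can be used in both directions, each horizontal line is one-way, and every vertex has exactly $3$ outgoing edges. The simple random walk on this graph is the $\mathbb{Z}^2$-valued Markov chain $(M_n)_{n\ge 0}$ started at $M_0=(0,0)$ that at each step follows one of the $3$ outgoing edges of its current position with probability $1/3$ each. Recurrence and transience are meant in the usual sense for (irreducible) Markov chains. *)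

(* Defs.v *)
From HB Require Import structures.
From mathcomp Require Import all_boot all_order all_algebra.
From mathcomp Require Import all_classical all_reals all_analysis.

Set Implicit Arguments.
Unset Strict Implicit.
Unset Printing Implicit Defensive.

Import Order.TTheory GRing.Theory Num.Theory.

Local Open Scope classical_set_scope.
Local Open Scope ring_scope.

(* [X] is a Markov chain on [(Omega, P)] with transition probabilities [p]
   started at [x].  The Markov property is written without conditional
   probabilities, so no positivity side condition on the past is needed. *)
Definition markov_chain (R : realType) (S : countType) (p : S -> S -> R)
    (x : S) (d : measure_display) (Omega : measurableType d)
    (P : probability Omega R) (X : nat -> Omega -> S) : Prop :=
  [/\ forall n s, measurable (X n @^-1` [set s]),
      P (X 0%N @^-1` [set x]) = 1%E
    & forall n (s : nat -> S),
        P [set w | forall i, (i <= n.+1)%N -> X i w = s i] =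
        (P [set w | forall i, (i <= n)%N -> X i w = s i]
          * (p (s n) (s n.+1))%:E)%E].

Definition recurrent_state (R : realType) (S : countType) (p : S -> S -> R)
    (x : S) : Prop :=
  forall (d : measure_display) (Omega : measurableType d)
    (P : probability Omega R) (X : nat -> Omega -> S),
    markov_chain p x P X ->
    P [set w | exists2 n, (0 < n)%N & X n w = x] = 1%E.

Definition recurrent (R : realType) (S : countType) (p : S -> S -> R) : Prop :=
  forall x, recurrent_state p x.

Definition oriented_edge (eps : int -> int) (u v : int * int) : bool :=
  ((v.1 == u.1) && ((v.2 == u.2 + 1) || (v.2 == u.2 - 1)))
  || ((v.2 == u.2) && (v.1 == u.1 + eps u.2)).

Definition srw (R : realType) (eps : int -> int) (u v : int * int) : R :=
  if oriented_edge eps u v then 3%:R^-1 else 0.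

(* [^] is the integer power: [y] may be negative, and [-1] is a unit. *)
Definition alternate (y : int) : int := (-1) ^ y.

Lemma alternate_pm1 (y : int) : alternate y = 1 \/ alternate y = -1.
Proof.
rewrite /alternate; case: y => n; rewrite ?NegzE -?exprnN -?exprnP.
  by rewrite -signr_odd; case: (odd n); [right|left].
by rewrite -signr_odd; case: (odd n.+1); [right|left].
Qed.

(* Main.v *)
(* By the last-exit decomposition, the probability [h] of avoiding [x] at times
   1, ..., n satisfies [h * G <= 1], where [G] is the expected number of visits to
   [x] up to time [n]; so it suffices to show that [G] is unbounded.  If [u] and
   [x] lie on rows of opposite parity, the point reflection exchanging them is an
   automorphism of the alternate lattice, hence p_n(u,x) = p_n(x,u) and
   p_2n(x,x) >= sum_u p_n(x,u)^2 over such [u].  After n steps the walk is on a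
   row of opposite parity with probability at least 1/3, and by Chebyshev's
   inequality it is outside a box of side O(sqrt n) with probability at most 1/6;
   Cauchy-Schwarz on the O(n) points left gives p_2n(x,x) >= c / n. *)

Require Import Defs.
From mathcomp Require Import all_boot all_order all_algebra.
From mathcomp Require Import all_classical all_reals all_analysis.
From mathcomp Require Import ring lra zify.

Set Implicit Arguments.
Unset Strict Implicit.
Unset Printing Implicit Defensive.

Import Order.TTheory GRing.Theory Num.Theory.

Local Open Scope classical_set_scope.
Local Open Scope ring_scope.

Lemma alternateS (y : int) : alternate (y + 1) = - alternate y.
Proof. by rewrite /alternate exprzDr ?unitrN1 // expr1z mulrN1. Qed.

Lemma alternateB1 (y : int) : alternate (y - 1) = - alternate y.
Proof. by rewrite -{2}(subrK 1 y) alternateS opprK. Qed.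

Lemma alternateN (y : int) : alternate (- y) = alternate y.
Proof. by rewrite /alternate -exprz_inv. Qed.

Lemma alternateD (y z : int) : alternate (y + z) = alternate y * alternate z.
Proof. by rewrite /alternate exprzDr ?unitrN1. Qed.

(** * The averaging operator of the walk and its iterates *)

Section averaging.
Context {R : realType}.
Implicit Types (f g : int * int -> R) (u v x : int * int) (n m : nat).

Definition avg f u : R :=
  (f (u.1, u.2 + 1)%R + f (u.1, u.2 - 1)%R
   + f (u.1 + alternate u.2, u.2)%R) / 3.

Lemma avgE f u : avg f u =
  (f (u.1, u.2 + 1)%R + f (u.1, u.2 - 1)%R
   + f (u.1 + alternate u.2, u.2)%R) / 3.
Proof. by []. Qed.

Definition sgn u : R := (alternate u.2)%:~R.

Lemma sqr_sgn u : sgn u * sgn u = 1.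
Proof.
by rewrite /sgn; case: (alternate_pm1 u.2) => ->;
  rewrite -intrM ?mulrNN mulr1.
Qed.

(** The two vertical moves flip the row parity and the horizontal one keeps it, so [sgn] is an
    eigenfunction of eigenvalue (-1 - 1 + 1) / 3. *)
Lemma avg_sgn u : avg sgn u = - sgn u / 3.
Proof.
rewrite /avg /sgn /= alternateS alternateB1 !mulrNz; field=> //.
Qed.

(* The probability of going from [u] to [v] in [n] steps. *)
Definition nstep n v u : R := iter n avg (fun w => (w == v)%:R) u.
#[local] Arguments nstep : simpl never.

Lemma iter_avg_le n f g :
  (forall u, f u <= g u) -> forall u, iter n avg f u <= iter n avg g u.
Proof.
move=> fg; elim: n => //= n IH u.
by rewrite /avg ler_pM2r ?invr_gt0 ?ltr0n// !lerD.
Qed.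

Lemma avg_le f g : (forall u, f u <= g u) -> forall u, avg f u <= avg g u.
Proof. by move=> fg u; exact: (iter_avg_le 1 fg u). Qed.

Lemma iter_avgD n f g u :
  iter n avg (fun w => f w + g w) u = iter n avg f u + iter n avg g u.
Proof.
elim: n u => //= n IH u; rewrite /avg !IH; field=> //.
Qed.

Lemma iter_avgZ n (c : R) f u :
  iter n avg (fun w => c * f w) u = c * iter n avg f u.
Proof.
elim: n u => //= n IH u; rewrite /avg !IH; field=> //.
Qed.

Lemma iter_avg_cst n (c : R) u : iter n avg (fun=> c) u = c.
Proof. by elim: n u => //= n IH u; rewrite /avg !IH; field. Qed.

Lemma iter_avg_sum n (I : Type) (s : seq I) (F : I -> int * int -> R) u :
  iter n avg (fun w => \sum_(i <- s) F i w) u = \sum_(i <- s) iter n avg (F i) u.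
Proof.
elim: s => [|i s IH].
  rewrite big_nil -[RHS](iter_avg_cst n 0 u); congr (iter _ _ _ _).
  by apply/funext => w; rewrite big_nil.
rewrite big_cons -IH -iter_avgD; congr (iter _ _ _ _).
by apply/funext => w; rewrite big_cons.
Qed.

Lemma nstep_ge0 n v u : 0 <= nstep n v u.
Proof.
by rewrite -(iter_avg_cst n 0 u); apply: iter_avg_le => w; rewrite ler0n.
Qed.

(** * Point reflection and return probabilities at even times *)

(* For [c = u + v] with [u], [v] on rows of opposite parity, the point
   reflection exchanging [u] and [v] is an automorphism of the lattice. *)
Lemma iter_avg_reflect (c : int * int) n f u : alternate c.2 = -1 ->
  iter n avg (fun w => f (c - w)) u = iter n avg f (c - u).
Proof.
have cB a b : c - (a, b) = (c.1 - a, c.2 - b) by case: c.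
move=> oc; elim: n u => // n IH [a b]; rewrite !iterS !avgE !IH !cB /=.
have -> : alternate (c.2 - b) = - alternate b.
  by rewrite alternateD alternateN oc mulN1r.
by rewrite !opprD !opprK !addrA [X in X + _]addrC.
Qed.

Lemma nstep_sym n u v :
  alternate (u + v).2 = -1 -> nstep n u v = nstep n v u.
Proof.
move=> oc.
rewrite /nstep -[X in iter _ _ _ X = _](addKr u) addrC.
rewrite -(iter_avg_reflect _ _ _ oc); congr (iter _ _ _ _).
by apply/funext => w; congr (_%:R); rewrite subr_eq (inj_eq (addrI _)) eq_sym.
Qed.

Lemma sum_delta (B : seq (int * int)) u : uniq B ->
  \sum_(v <- B) (u == v)%:R = (u \in B)%:R :> R.
Proof.
move=> uB; rewrite -natr_sum -count_uniq_mem// -sum1_count [in RHS]big_mkcond /=.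
by congr (_%:R); apply: eq_bigr => v _; rewrite eq_sym; case: (v == u).
Qed.

(* [p ^+ 2 >= 2 * t * p - t ^+ 2] plays the role of the Cauchy-Schwarz
   inequality, which is recovered by optimising over [t]. *)
Lemma nstep_double_ge n x (B : seq (int * int)) (t : R) : uniq B ->
  {in B, forall v, alternate (x + v).2 = -1} ->
  2 * t * iter n avg (fun w => (w \in B)%:R) x - t ^+ 2 * (size B)%:R
    <= nstep n.*2 x x.
Proof.
move=> uB oB.
have -> : iter n avg (fun w => (w \in B)%:R) x = \sum_(v <- B) nstep n v x.
  rewrite -iter_avg_sum; congr (iter _ _ _ _).
  by apply/funext => w; rewrite sum_delta.
apply: (@le_trans _ _ (\sum_(v <- B) nstep n x v * nstep n v x)).
  have -> : t ^+ 2 * (size B)%:R = \sum_(v <- B) t ^+ 2.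
    by rewrite big_const_seq count_predT iter_addr_0 mulr_natr.
  rewrite mulr_sumr -sumrB.
  rewrite ![leLHS]big_seq ![leRHS]big_seq; apply: ler_sum => v vB.
  rewrite (nstep_sym _ (oB _ vB)) -subr_ge0.
  set p := nstep _ _ _.
  have -> : p * p - (2 * t * p - t ^+ 2) = (p - t) ^+ 2 by ring.
  exact: sqr_ge0.
(* Chapman-Kolmogorov with midpoints restricted to [B]: [nstep n x] dominates its restriction to
   [B], which is a combination of point indicators. *)
rewrite [leRHS]/nstep -addnn iterD.
under eq_bigr do rewrite -iter_avgZ.
rewrite -iter_avg_sum; apply: iter_avg_le => w.
rewrite -[leRHS]mulr1; apply: (@le_trans _ _ (nstep n x w * (w \in B)%:R)).
  rewrite -sum_delta// mulr_sumr; apply: ler_sum => v _.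
  by case: eqP => [->|]; rewrite ?mulr0.
by rewrite ler_wpM2l ?nstep_ge0// lern1 leq_b1.
Qed.

(** * Second moments and concentration in a box *)

(* [sgn / 4] is the corrector making the first coordinate a martingale. *)
Definition sqdist x u : R :=
  ((u.1 - x.1)%:~R + sgn u / 4) ^+ 2 + (u.2 - x.2)%:~R ^+ 2.

(** With [s = sgn u], the corrected first coordinate has increments -s/2, -s/2 and s, of mean 0 and
    variance 1/2; the second coordinate has mean 0 and variance 2/3. *)
Lemma avg_sqdist x u : avg (sqdist x) u = sqdist x u + 7 / 6.
Proof.
have := sqr_sgn u.
rewrite /avg /sqdist /sgn /= alternateS alternateB1.
rewrite !(intrD, mulrNz).
move: (alternate _)%:~R => s s2.
have -> : 7 / 6 = (2 + 3 / 2 * (s * s)) / 3 :> R by rewrite s2; field=> //.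
by field.
Qed.

Lemma iter_avg_sqdist n x u :
  iter n avg (sqdist x) u = sqdist x u + 7 / 6 * n%:R.
Proof.
elim: n u => [|n IH] u; first by rewrite mulr0 addr0.
rewrite iterS (_ : iter n avg _ = fun w => sqdist x w + 7 / 6 * n%:R); last exact/funext.
transitivity (avg (sqdist x) u + 7 / 6 * n%:R); first by rewrite /avg; field=> //.
by rewrite avg_sqdist -natr1; ring.
Qed.

Lemma iter_avg_sgn n u : iter n avg sgn u = (- 3^-1) ^+ n * sgn u.
Proof.
elim: n u => [|n IH] u; first by rewrite mul1r.
rewrite iterS (_ : iter n avg _ = fun w => (- 3^-1) ^+ n * sgn w); last exact/funext.
transitivity ((- 3^-1) ^+ n * avg sgn u); first by rewrite /avg; field=> //.
by rewrite avg_sgn exprSr; ring.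
Qed.

Lemma sqdist_ge0 x u : 0 <= sqdist x u :> R.
Proof. by rewrite addr_ge0 ?sqr_ge0. Qed.

Lemma sgnM x u : sgn x * sgn u = (alternate (x + u).2)%:~R :> R.
Proof. by rewrite /= alternateD intrM. Qed.

Definition box x r : seq (int * int) :=
  [seq v <- [seq (x.1 - r%:Z + i%:Z, x.2 - r%:Z + j%:Z)
              | i <- iota 0 r.*2.+1, j <- iota 0 r.*2.+1]
          | alternate (x + v).2 == -1].

Lemma box_uniq x r : uniq (box x r).
Proof.
rewrite filter_uniq// allpairs_uniq ?iota_uniq// => -[i j] [i' j'] _ _ /=.
by case=> /addrI[->] /addrI[->].
Qed.

Lemma size_box x r : (size (box x r) <= r.*2.+1 ^ 2)%N.
Proof.
rewrite size_filter (leq_trans (count_size _ _))//.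
by rewrite size_allpairs !size_iota mulnn.
Qed.

Lemma mem_box x r u : `|u.1 - x.1| <= r%:Z -> `|u.2 - x.2| <= r%:Z ->
  alternate (x + u).2 = -1 -> u \in box x r.
Proof.
move=> u1 u2 xu; rewrite mem_filter xu eqxx andTb.
apply/allpairsP; exists (absz (u.1 - x.1 + r%:Z)%R, absz (u.2 - x.2 + r%:Z)%R).
rewrite !mem_iota /=; split; [lia|lia|].
by case: u u1 u2 {xu} => a b /= u1 u2; congr pair; lia.
Qed.

(** An integer of absolute value above [r] is at least [r + 1] in absolute value, which leaves room
    for the corrector, of size 1/4. *)
Lemma sqdist_out x r u :
  ~~ ((`|u.1 - x.1| <= r%:Z) && (`|u.2 - x.2| <= r%:Z)) ->
  r%:R ^+ 2 <= sqdist x u :> R.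
Proof.
have := sqr_sgn u; rewrite /sqdist.
move: (u.1 - x.1 : int) (u.2 - x.2 : int) (sgn u : R) => a b s s2.
have s1 : - 1 <= s <= 1 by apply/andP; split; nra.
have big (d : int) : ~~ (`|d| <= r%:Z) ->
    (r%:R + 1 <= d%:~R :> R) \/ (d%:~R <= - (r%:R + 1) :> R).
  move=> dr; have [dr1|dr1] : (r%:Z + 1 <= d)%R \/ (d <= - (r%:Z + 1))%R by lia.
    by left; rewrite -(ler_int R) intrD in dr1; exact: dr1.
  by right; rewrite -(ler_int R) mulrNz intrD in dr1; exact: dr1.
have r0 : 0 <= r%:R :> R by rewrite ler0n.
have sq (y : R) : r%:R <= y \/ y <= - r%:R -> r%:R ^+ 2 <= y ^+ 2 by case; nra.
rewrite negb_and => /orP[] /big h.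
  have {}h : r%:R <= a%:~R + s / 4 \/ a%:~R + s / 4 <= - r%:R.
    by case: h => h; [left|right]; lra.
  by rewrite (le_trans (sq _ h))// lerDl sqr_ge0.
have {}h : r%:R <= b%:~R :> R \/ b%:~R <= - r%:R :> R.
  by case: h => h; [left|right]; lra.
by rewrite (le_trans (sq _ h))// lerDr sqr_ge0.
Qed.

(** Chebyshev's inequality before integration: the first two terms form the indicator of the rows of
    parity opposite to that of [x], and the third is at most -1 off the square of radius [r]. The
    iterates of all three are explicit. *)
Lemma box_indicator_ge x r u : (0 < r)%N ->
  2^-1 + - (sgn x / 2) * sgn u + - (r%:R ^- 2) * sqdist x u
    <= (u \in box x r)%:R :> R.
Proof.
move=> r0; have rR : 0 < r%:R ^+ 2 :> R by rewrite exprn_gt0 ?ltr0n.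
have q0 : 0 <= r%:R ^- 2 * sqdist x u :> R.
  by rewrite mulr_ge0 ?sqdist_ge0 ?invr_ge0 ?ltW.
have : sgn x * sgn u = 1 :> R \/ u \in box x r \/ 1 <= r%:R ^- 2 * sqdist x u :> R.
  rewrite sgnM; case: (alternate_pm1 (x + u).2) => xu; first by left; rewrite xu.
  right; have [/andP[h1 h2]|h] := boolP ((`|u.1 - x.1| <= r%:Z) && (`|u.2 - x.2| <= r%:Z)).
    by left; exact: mem_box.
  by right; rewrite mulrC ler_pdivlMr ?mul1r ?sqdist_out.
have xu2 : - 1 <= (sgn x * sgn u : R) <= 1.
  by rewrite sgnM; case: (alternate_pm1 (x + u).2) => ->; rewrite ?mulrNz; lra.
have b0 : 0 <= (u \in box x r)%:R :> R by rewrite ler0n.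
have -> : 2^-1 + - (sgn x / 2) * sgn u + - r%:R ^- 2 * sqdist x u
    = 2^-1 - (sgn x * sgn u) / 2 - r%:R ^- 2 * sqdist x u :> R by ring.
move: (sgn x * sgn u) (r%:R ^- 2 * _) q0 xu2 => p q q0 p1.
by case=> [->|[->|q1]]; rewrite /=; lra.
Qed.

Lemma iter_avg_box_ge n x r : (0 < n)%N -> (8 * n <= r ^ 2)%N ->
  6^-1 <= iter n avg (fun w => (w \in box x r)%:R) x :> R.
Proof.
move=> n0 nr; have r0 : (0 < r)%N by move: n0 nr; case: r => //; case: n.
have rR : 0 < r%:R ^+ 2 :> R by rewrite exprn_gt0 ?ltr0n.
apply: le_trans (iter_avg_le _ (fun u => box_indicator_ge x u r0) x).
rewrite iter_avgD iter_avgD iter_avg_cst !iter_avgZ iter_avg_sgn iter_avg_sqdist.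
have -> : sqdist x x = 16^-1 :> R.
  by rewrite /sqdist !subrr expr0n add0r addr0 exprMn expr2 sqr_sgn mul1r; field.
have p3 : `|(- 3^-1) ^+ n| <= 3^-1 :> R.
  rewrite normrX normrN ger0_norm ?invr_ge0// -[leRHS]expr1.
  by rewrite ler_wiXn2l ?invr_ge0//; lra.
have sx : - (sgn x / 2) * ((- 3^-1) ^+ n * sgn x) = - (- 3^-1) ^+ n / 2 :> R.
  transitivity (- (- 3^-1) ^+ n / 2 * (sgn x * sgn x) : R); first by field.
  by rewrite sqr_sgn mulr1.
have nr' : 8 * n%:R <= r%:R ^+ 2 :> R by rewrite -natrX -natrM ler_nat.
have n1 : 1 <= n%:R :> R by rewrite ler1n.
(* Since [r ^ 2] is at least [8 n], the quotient is at most (1/16 + 7/6) / 8 < 1/6. The parity terms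
   give at least 1/2 - 1/6 = 1/3, which leaves 1/6. *)
have : r%:R ^- 2 * (16^-1 + 7 / 6 * n%:R) <= 6^-1 :> R.
  by rewrite mulrC ler_pdivrMr//; lra.
have -> : - r%:R ^- 2 * (16^-1 + 7 / 6 * n%:R)
  = - (r%:R ^- 2 * (16^-1 + 7 / 6 * n%:R)) :> R by rewrite mulNr.
rewrite sx; move: (r%:R ^- 2 * _) p3 => q; rewrite ler_norml => /andP[]; lra.
Qed.

(** * The bound c / n and the divergence of the expected number of visits *)

Lemma nstep_double_ge_pow4 n j x : (0 < n < 4 ^ j.+1)%N ->
  (6084 * 4 ^+ j)^-1 <= nstep n.*2 x x :> R.
Proof.
(* This radius gives r^2 = 36 * 4^j > 8 n, and the box has at most (12 * 2^j + 1)^2 <= 169 * 4^j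
   points. *)
move=> /andP[n0 nj]; set r := (6 * 2 ^ j)%N.
have r2 : (r ^ 2 = 36 * 4 ^ j)%N by rewrite /r expnMn -!expnM (mulnC j) expnM.
have nr : (8 * n <= r ^ 2)%N by rewrite r2; move: nj; rewrite expnS; lia.
have j1 : 1 <= 2 ^+ j :> R by rewrite exprn_ege1// ler1n.
(* The maximiser of 2 t q - t^2 N for q = 1/6 and N = 169 * 4^j; the maximum is q^2 / N = 1 / (6084
   * 4^j). *)
set t := (6 * 169 * 4 ^+ j)^-1 : R.
have s4 : (size (box x r))%:R <= 169 * 4 ^+ j :> R.
  apply: (@le_trans _ _ ((r.*2.+1 ^ 2)%:R)); first by rewrite ler_nat size_box.
  rewrite natrX -natr1 -muln2 !natrM natrX.
  have -> : 4 ^+ j = (2 ^+ j) ^+ 2 :> R by rewrite -exprM mulnC exprM -(natrX _ 2 2).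
  move: (2 ^+ j) j1 => a; nra.
have j4 : 0 < 4 ^+ j :> R by rewrite exprn_gt0.
have t0 : 0 < t by rewrite invr_gt0 !mulr_gt0.
have tj : t * (169 * 4 ^+ j) = 6^-1 by rewrite /t; field; rewrite gt_eqF.
apply: le_trans (nstep_double_ge n t (box_uniq x r) _); last first.
  by move=> v; rewrite mem_filter => /andP[/eqP].
have := iter_avg_box_ge x n0 nr; move: (iter n _ _ _) => q q6.
have -> : (6084 * 4 ^+ j)^-1 = t / 6 by rewrite /t; field; rewrite ?gt_eqF.
have h1 : t ^+ 2 * (size (box x r))%:R <= t / 6.
  by rewrite -tj expr2 -mulrA ler_pM2l// ler_pM2l.
have h2 : t / 6 <= t * q by rewrite ler_pM2l.
lra.
Qed.

Lemma sum_nstep_double_le n x :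
  \sum_(0 <= k < n) nstep k.*2 x x <= \sum_(0 <= k < n.*2) nstep k x x :> R.
Proof.
elim: n => [|n IH]; first by rewrite !big_nil.
rewrite doubleS !big_nat_recr//=.
by rewrite -addrA lerD// lerDl nstep_ge0.
Qed.

(** The block of [k] from 4^j to 4^(j+1) - 1 has 3 * 4^j terms, each at least 1 / (6084 * 4^j), so
    every block contributes at least 3 / 6084 = 1 / 2028. *)
Lemma sum_nstep_ge j x :
  j%:R / 2028 <= \sum_(0 <= k < (4 ^ j).*2) nstep k x x :> R.
Proof.
apply: le_trans (sum_nstep_double_le _ _).
elim: j => [|j IH].
  by rewrite mul0r sumr_ge0// => k _; exact: nstep_ge0.
have j4 : 0 < 4 ^+ j :> R by rewrite exprn_gt0.
rewrite -natr1 mulrDl (@big_cat_nat _ _ _ (4 ^ j)%N) ?leq_pexp2l//=.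
rewrite lerD//.
apply: (@le_trans _ _ (\sum_(4 ^ j <= k < 4 ^ j.+1) (6084 * 4 ^+ j)^-1)).
  rewrite sumr_const_nat expnS.
  have -> : (4 * 4 ^ j - 4 ^ j = 3 * 4 ^ j)%N by lia.
  rewrite -[leRHS]mulr_natr natrM natrX le_eqVlt; apply/orP; left; apply/eqP.
  by field; rewrite ?gt_eqF.
rewrite [leLHS]big_nat [leRHS]big_nat; apply: ler_sum => k /andP[k1 k2].
by rewrite nstep_double_ge_pow4// k2 andbT (leq_trans _ k1)// expn_gt0.
Qed.

(** * Avoidance probabilities and the last-exit decomposition *)

(* The probability that the walk from [u] is not at [x] at times 1, ..., n. *)
Fixpoint avoid x n u : R :=
  if n is m.+1 then avg (fun v => (v != x)%:R * avoid x m v) u else 1.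

Lemma avoid_ge0 x n u : 0 <= avoid x n u.
Proof.
elim: n u => //= n IH u; rewrite -[leLHS](iter_avg_cst 1 0 u).
by apply: avg_le => v; rewrite mulr_ge0// ler0n.
Qed.

Lemma avoidS_le x n u : avoid x n.+1 u <= avoid x n u.
Proof.
elim: n u => [|n IH] u /=.
  rewrite -[leRHS](iter_avg_cst 1 1 u).
  by apply: avg_le => v; rewrite mulr1 lern1 leq_b1.
by apply: avg_le => v; apply: ler_wpM2l (IH v); rewrite ler0n.
Qed.

Lemma avoid_le x n m u : (n <= m)%N -> avoid x m u <= avoid x n u.
Proof.
move=> nm; apply: (@homo_leq _ (fun k => avoid x k u) (fun a b => b <= a)) nm => //.
- by move=> a b c ba cb; exact: le_trans cb ba.
- by move=> k; exact: avoidS_le.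
Qed.

(* Decomposition according to the last visit to [x] before time [n]. *)
Lemma last_exit x n u :
  \sum_(0 <= k < n.+1) nstep k x u * avoid x (n - k) x
    = 1 - (u != x)%:R * avoid x n u.
Proof.
elim: n u => [|n IH] u.
  by rewrite big_nat1 /nstep /= !mulr1; case: eqP => _; rewrite ?subr0 ?subrr.
rewrite big_nat_recl// subn0.
under eq_bigr => k _ do rewrite subSS.
(* Conditioning on the first step: apply [avg] to the induction hypothesis. *)
have -> : \sum_(0 <= k < n.+1) nstep k.+1 x u * avoid x (n - k) x
    = 1 - avoid x n.+1 u.
  transitivity (avg (fun v => 1 - (v != x)%:R * avoid x n v) u).
    rewrite -(funext IH) -[RHS]/(iter 1 avg _ u) iter_avg_sum.
    apply: eq_bigr => k _; rewrite mulrC.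
    rewrite -[nstep k.+1 x u]/(iter 1 avg (nstep k x) u) -iter_avgZ.
    by congr (iter _ _ _ _); apply/funext => v; rewrite mulrC.
  by rewrite /= !avgE; field.
rewrite {1}/nstep [iter 0 _ _ _]/=; case: (eqVneq u x) => [->|_].
  by rewrite mul1r mul0r; ring.
by rewrite mul0r mul1r add0r.
Qed.

(** At [u = x] the last-exit sum equals 1, and each factor [avoid x (n - k) x] is at least
    [avoid x n x]. *)
Lemma avoid_mul_sum_nstep_le1 x n :
  avoid x n x * \sum_(0 <= k < n.+1) nstep k x x <= 1.
Proof.
have := last_exit x n x; rewrite eqxx mul0r subr0 => le1; rewrite -[leRHS]le1.
rewrite mulr_sumr ler_sum// => k _.
by rewrite mulrC ler_wpM2l ?nstep_ge0// avoid_le// leq_subr.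
Qed.

Lemma avoid_small x (e : R) : 0 < e -> exists n, avoid x n x <= e.
Proof.
move=> e0; have [j je] : exists j, e^-1 <= j%:R / 2028.
  have : 0 < 2028 :> R by rewrite ltr0n.
  move: (2028 : R) => c c0; exists (Num.bound (e^-1 * c)).
  rewrite ler_pdivlMr// ltW// archi_boundP// ltW// mulr_gt0//.
  by rewrite invr_gt0.
exists (4 ^ j).*2.-1.
have j0 : (0 < (4 ^ j).*2)%N by rewrite double_gt0 expn_gt0.
have := avoid_mul_sum_nstep_le1 x (4 ^ j).*2.-1; rewrite prednK//.
move=> h; have g := le_trans je (sum_nstep_ge j x).
rewrite -[leRHS]invrK -[leRHS]mul1r ler_pdivlMr ?invr_gt0//.
by apply: le_trans h; rewrite ler_wpM2l// avoid_ge0.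
Qed.

End averaging.

Lemma neighbours_uniq (u : int * int) :
  uniq [:: (u.1, u.2 + 1); (u.1, u.2 - 1); (u.1 + alternate u.2, u.2)].
Proof.
by rewrite /= !inE !xpair_eqE; case: (alternate_pm1 u.2) => ->; lia.
Qed.

Lemma srw_neighbour (R : realType) (u v : int * int) :
  v \in [:: (u.1, u.2 + 1); (u.1, u.2 - 1); (u.1 + alternate u.2, u.2)] ->
  srw R alternate u v = 3^-1.
Proof.
rewrite /srw /oriented_edge !inE => /or3P[] /eqP -> /=;
  by rewrite !eqxx ?orbT.
Qed.

(** * Transfer from the averaging operator to an arbitrary realisation of the chain *)

Section avoidance.
Context {R : realType} {d : measure_display} {Omega : measurableType d}.
Variables (P : probability Omega R) (X : nat -> Omega -> int * int).
Hypothesis mX : forall n s, measurable (X n @^-1` [set s]).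
Hypothesis stepX : forall n (s : nat -> int * int),
  P [set w | forall i, (i <= n.+1)%N -> X i w = s i] =
  (P [set w | forall i, (i <= n)%N -> X i w = s i]
    * (srw R alternate (s n) (s n.+1))%:E)%E.

Definition follows (s : nat -> int * int) m : set Omega :=
  [set w | forall i, (i <= m)%N -> X i w = s i].

Definition avoids x m n : set Omega :=
  [set w | forall i, (m < i <= m + n)%N -> X i w <> x].

Lemma measurable_follows s m : measurable (follows s m).
Proof.
rewrite (_ : follows s m = \bigcap_(i in [set i | (i <= m)%N]) (X i @^-1` [set s i])).
  by apply: bigcap_measurableType => k _; exact: mX.
by apply/seteqP; split.
Qed.

Lemma measurable_avoids x m n : measurable (avoids x m n).
Proof.
rewrite (_ : avoids x m n =
  \bigcap_(i in [set i | (m < i <= m + n)%N]) ~` (X i @^-1` [set x])).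
  by apply: bigcap_measurableType => k _; exact/measurableC/mX.
by apply/seteqP; split.
Qed.

Definition extend (s : nat -> int * int) m v i := if (i <= m)%N then s i else v.

Lemma follows_extend s m v :
  follows (extend s m v) m.+1 = follows s m `&` X m.+1 @^-1` [set v].
Proof.
apply/seteqP; split=> w /=.
  move=> h; split=> [i im|]; first by rewrite h ?leqW// /extend im.
  by rewrite h// /extend ltnn.
move=> [h1 h2] i; rewrite leq_eqVlt ltnS => /orP[/eqP ->|im].
  by rewrite h2 /extend ltnn.
by rewrite h1// /extend im.
Qed.

Lemma prob_follows_extend s m v :
  v \in [:: ((s m).1, (s m).2 + 1); ((s m).1, (s m).2 - 1);
            ((s m).1 + alternate (s m).2, (s m).2)] ->
  P (follows (extend s m v) m.+1) = (P (follows s m) * (3^-1)%:E)%E.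
Proof.
move=> vs; rewrite /follows stepX; congr (P _ * _)%E.
  apply/seteqP; split=> w h i im; have := h i im; rewrite /extend im//.
by rewrite /extend leqnn ltnn srw_neighbour.
Qed.

(** The three continuations are disjoint and each carries a third of the mass of [follows s m], so
    no mass is left for other positions at time [m.+1]. *)
Lemma prob_leave_neighbours s m (u := s m) :
  P (follows s m `\` (follows (extend s m (u.1, u.2 + 1)%R) m.+1
    `|` follows (extend s m (u.1, u.2 - 1)%R) m.+1
    `|` follows (extend s m (u.1 + alternate u.2, u.2)%R) m.+1)) = 0%E.
Proof.
set v1 := (u.1, _ + _); set v2 := (u.1, _); set v3 := (_, u.2).
have mf v k : measurable (follows v k) by exact: measurable_follows.
have dis v v' : v != v' ->
    follows (extend s m v) m.+1 `&` follows (extend s m v') m.+1 = set0.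
  move=> /eqP vv'; rewrite !follows_extend -subset0 => w [[_ /= e1] [_ /= e2]].
  by apply: vv'; rewrite -e1.
have /= := neighbours_uniq u; rewrite -/v1 -/v2 -/v3 !inE negb_or andbT.
move=> /andP[/andP[v12 v13] v23].
rewrite measureD//=; last 2 first.
- by do 2 apply: measurableU => //.
- by rewrite ltey_eq fin_num_measure.
rewrite setIidr; last first.
  by move=> w [[]|]; rewrite follows_extend => -[].
rewrite measureU//=; last 2 first.
- exact: measurableU.
- by rewrite setIUl !dis// setU0.
rewrite measureU//= ?dis// !prob_follows_extend ?inE ?eqxx ?orbT//.
have /fineK <- : P (follows s m) \is a fin_num by rewrite fin_num_measure.
move: (fine _) => p; transitivity (p - (p / 3 + p / 3 + p / 3))%:E => //.
by congr (_%:E); field.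
Qed.

(** Induction on [n] over all pasts, splitting by the position at time [m.+1]. Only an upper bound
    is sought, so subadditivity suffices. *)
Lemma prob_avoids_le x n m s :
  (P (follows s m `&` avoids x m n) <= P (follows s m) * (avoid x n (s m))%:E)%E.
Proof.
elim: n m s => [|n IH] m s.
  rewrite mule1; apply: le_measure; rewrite ?inE.
  - by apply: measurableI; [exact: measurable_follows|exact: measurable_avoids].
  - exact: measurable_follows.
  - exact: subIsetl.
set u := s m; set A := follows s m.
set v1 := (u.1, u.2 + 1); set v2 := (u.1, u.2 - 1); set v3 := (u.1 + alternate u.2, u.2).
pose E v := follows (extend s m v) m.+1.
pose C v := E v `&` [set w | v <> x] `&` avoids x m.+1 n.
pose D := A `\` (E v1 `|` E v2 `|` E v3).
have mE v : measurable (E v) by exact: measurable_follows.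
have mC v : measurable (C v).
  apply: measurableI; last exact: measurable_avoids.
  have [->|vx] := pselect (v = x).
    rewrite (_ : [set w | _] = set0) ?setI0//.
    by rewrite -subset0 => w /=.
  by rewrite (_ : [set w | _] = setT) ?setIT//; apply/seteqP; split.
have mD : measurable D.
  apply: measurableD; first exact: measurable_follows.
  by do 2 apply: measurableU => //.
have mA : measurable A by exact: measurable_follows.
have sub : A `&` avoids x m n.+1 `<=` C v1 `|` C v2 `|` C v3 `|` D.
  move=> w [Aw aw].
  have cv v : E v w -> C v w.
    move=> Ew; have := Ew; rewrite /E follows_extend => -[_ /= xv].
    split; first split => //.
      by rewrite -xv; apply: aw; rewrite leqnn addnS ltnS leq_addr.
    by move=> i /andP[mi im]; apply: aw; rewrite (ltnW mi) addnS -addSn.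
  have [[[/cv|/cv]|/cv]|nE] := pselect ((E v1 `|` E v2 `|` E v3) w).
  - by move=> ?; left; left; left.
  - by move=> ?; left; left; right.
  - by move=> ?; left; right.
  - by right; split.
(* For [v = x] the event is empty, matching the factor [v != x]; otherwise the induction hypothesis
   applies to the extended path. *)
have PC v : v \in [:: v1; v2; v3] ->
    (P (C v) <= P A * (3^-1 * ((v != x)%:R * avoid x n v))%:E)%E.
  move=> vs; have [->|/eqP vx] := eqVneq v x.
    rewrite (_ : C x = set0) ?measure0 ?mul0r ?mulr0 ?mule0//.
    by rewrite -subset0 => w [[_ /=]].
  rewrite mul1r EFinM muleA -(prob_follows_extend vs).
  rewrite [X in avoid x n X](_ : v = extend s m v m.+1); last first.
    by rewrite /extend ltnn.
  apply: le_trans _ (IH _ _); apply: le_measure; rewrite ?inE//.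
  - by apply: measurableI; [exact: measurable_follows|exact: measurable_avoids].
  - by move=> w [[]].
apply: (@le_trans _ _ (P (C v1 `|` C v2 `|` C v3 `|` D))).
  apply: le_measure; rewrite ?inE//.
  - by apply: measurableI => //; exact: measurable_avoids.
  - by do 3 apply: measurableU => //.
apply: (@le_trans _ _ (P (C v1) + P (C v2) + P (C v3) + P D)%E).
  have U (F G : set Omega) : measurable F -> measurable G ->
    (P (F `|` G) <= P F + P G)%E by move=> *; exact: measureU2.
  do 2 (apply: le_trans (U _ _ _ _) _; rewrite ?leeD2r//;
    try by do ?apply: measurableU => //).
  by apply: U.
rewrite [P D]prob_leave_neighbours adde0.
apply: (le_trans (leeD (leeD (PC v1 _) (PC v2 _)) (PC v3 _)));
  rewrite ?inE ?eqxx ?orbT//.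
have /fineK <- : P A \is a fin_num by rewrite fin_num_measure.
rewrite -!EFinM -!EFinD lee_fin /= avgE -/u -/v1 -/v2 -/v3.
by rewrite le_eqVlt; apply/orP; left; apply/eqP; field.
Qed.

End avoidance.

Theorem theorem1p6 (R : realType) : recurrent (srw R alternate).
Proof.
move=> x d Omega P X [mX X0 stepX].
have mR : measurable [set w | exists2 n, (0 < n)%N & X n w = x].
  rewrite (_ : [set w | _] = \bigcup_(n in [set n | (0 < n)%N]) (X n @^-1` [set x])).
    by apply: bigcup_measurable => n _; exact: mX.
  by apply/seteqP; split=> w [n ? ?]; exists n.
apply/eqP; rewrite eq_le probability_le1//= leNgt; apply/negP => lt1.
have PRfin : P [set w | exists2 n, (0 < n)%N & X n w = x] \is a fin_num.
  by rewrite fin_num_measure.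
move: lt1; rewrite -(fineK PRfin) lte_fin -subr_gt0 => gap.
(* Half the gap, so that bounding the gap by [avoid x n x] is contradictory. *)
have [n hn] := avoid_small x (divr_gt0 gap (ltr0n R 2)).
have mN : measurable (~` (X 0%N @^-1` [set x])) by exact/measurableC/mX.
have mF : measurable (follows X (fun=> x) 0 `&` avoids X x 0 n).
  by apply: measurableI; [exact: measurable_follows|exact: measurable_avoids].
(* The chain starts at [x] only almost surely, so the null event of starting elsewhere is split
   off. *)
have : (P (~` [set w | exists2 n, (0 < n)%N & X n w = x])
    <= P (~` (X 0%N @^-1` [set x])) + P (follows X (fun=> x) 0 `&` avoids X x 0 n))%E.
  apply: le_trans (measureU2 _ mN mF).
  apply: le_measure; rewrite ?inE//; [exact: measurableC|exact: measurableU|].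
  move=> w /= nret; have [X0w|] := pselect (X 0%N w = x); last by left.
  right; split=> [i|i /andP[i0 _] Xi]; first by rewrite leqn0 => /eqP ->.
  by apply: nret; exists i.
rewrite !probability_setC//= X0 subee// add0e => h.
have {h} := le_trans h (prob_avoids_le mX stepX x n 0 (fun=> x)).
have -> : follows X (fun=> x) 0 = X 0%N @^-1` [set x].
  apply/seteqP; split=> w /= h; first by rewrite h.
  by move=> i; rewrite leqn0 => /eqP ->.
rewrite X0 mul1e -(fineK PRfin) -EFinB lee_fin => /le_trans /(_ hn).
by move: gap; set q := 1 - _; lra.
Qed.
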